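(* Let $p\in[1,\infty)$ and let $(X,d_X)$ be a metric space. If $X$ is locally Lipschitz-representable into $\ell_p$, then $X$ admits a bi-Lipschitz embedding into $\ell_p$.
   Context: For $\lambda\in[1,\infty)$, a metric space $(X,d_X)$ is locally $\lambda$-Lipschitz representable into a metric space $(Y,d_Y)$ if for every metric ball $B$ in $X$ there are a map $f_B\colon B\to Y$ and a scaling factor $s>0$ (which may depend on $B$) such that $s\,d_X(x,y)\le d_Y(f_B(x),f_B(y))\le \lambda s\, d_X(x,y)$ for all $x,y\in B$. It is locally Lipschitz-representable into $Y$ if it is locally $\lambda$-Lipschitz representable into $Y$ for some $\lambda\in[1,\infty)$ (the same $\lambda$ for all balls). A bi-Lipschitz embedding of $(X,d_X)$ into a Banach space $Z$ is a map $f\colon X\to Z$ for which there exist constants $s>0$ and $D\in[1,\infty)$ with $s\,d_X(x,y)\le \|f(x)-f(y)\|\le D s\,d_X(x,y)$ for all $x,y\in X$. Here $\ell_p$ is the usual space of $p$-summable real sequences. *)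

(* Defs.v *)
From HB Require Import structures.
From mathcomp Require Import all_boot all_order all_algebra finmap.
From mathcomp Require Import all_classical all_reals all_analysis.

Set Implicit Arguments.
Unset Strict Implicit.
Unset Printing Implicit Defensive.

Import Order.TTheory GRing.Theory Num.Theory.
Import numFieldNormedType.Exports.

Local Open Scope classical_set_scope.
Local Open Scope ring_scope.

Section lp_def.
Context {R : realType} {p : R} (p1 : 1 <= p).

(* L^p of the counting measure on nat: real sequences u with
   \sum_k |u_k|^p < +oo (every sequence is measurable); see [lp_normE] and
   [lp_ofP]. A set of counting measure 0 is empty, so no quotient is needed. *)
Definition lp : Type := LfunType (@counting nat R) (p1 : (1 <= p%:E)%E).

HB.instance Definition _ := GRing.Lmodule.on lp.

Definition lp_seq (u : lp) : nat -> R := u.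

Definition lp_norm (u : lp) : R :=
  fine ('N[@counting nat R]_(p%:E)[EFin \o lp_seq u])%E.

Let p_gt0 : 0 < p. Proof. exact: lt_le_trans p1. Qed.

Lemma lp_norm_EFin (u : lp) :
  (lp_norm u)%:E = ('N[@counting nat R]_(p%:E)[EFin \o lp_seq u])%E.
Proof. exact: finite_norm_fine. Qed.

Lemma lp_normD (u v : lp) : lp_norm (u + v) <= lp_norm u + lp_norm v.
Proof. exact: ler_LnormD. Qed.

Lemma lp_normZ (a : R) (u : lp) : lp_norm (a *: u) = `|a| * lp_norm u.
Proof. by apply: EFin_inj; rewrite EFinM !lp_norm_EFin LnormZ. Qed.

Lemma counting_eq0 (A : set nat) : @counting nat R A = 0%E -> A = set0.
Proof.
rewrite /counting; case: ifPn => // /asboolP finA [] /eqP.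
rewrite pnatr_eq0 cardfs_eq0 => /eqP A0.
by rewrite -(fset_setK finA) A0 set_fset0.
Qed.

Lemma lp_norm_eq0 (u : lp) : lp_norm u = 0 -> u = 0.
Proof.
move=> /fine_Lnormr_eq0 [A [_ A0 uA]]; apply/LfuneqP => k.
move/counting_eq0: A0 uA => -> uA; apply: contrapT => uk.
by apply: (uA k) => /= /(_ I).
Qed.

HB.instance Definition _ :=
  Lmodule_isNormed.Build R lp lp_normD lp_normZ lp_norm_eq0.

Let lp_dist_eq0 (u v : lp) : `|u - v| = 0 -> u = v.
Proof. by move/normr0_eq0/eqP; rewrite subr_eq0 => /eqP. Qed.

Let lp_ballE (u : lp) (e : R) : ball u e = [set v | `|u - v| < e].
Proof. by rewrite -ball_normE. Qed.

HB.instance Definition _ := @PseudoMetric_isMetric.Build R lp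
  (fun u v => `|u - v|) (fun u v => normr_ge0 _) lp_dist_eq0 lp_ballE.

Lemma lp_mdistE (u v : lp) : mdist u v = `|u - v|.
Proof. by []. Qed.

Lemma lp_normE (u : lp) :
  (`|u|%:E = (\sum_(k <oo) (`|lp_seq u k| `^ p)%:E) `^ p^-1)%E.
Proof. by rewrite [LHS]lp_norm_EFin Lnorm_counting. Qed.

Lemma lp_ofP (u : nat -> R) :
  (exists v : lp, lp_seq v = u) <-> (\sum_(k <oo) (`|u k| `^ p)%:E < +oo)%E.
Proof.
have uE : ((\sum_(k <oo) (`|u k| `^ p)%:E) =
    'N[@counting nat R]_(p%:E)[EFin \o u] `^ p)%E.
  rewrite poweR_Lnorm ?gt_eqF// ge0_integral_count// => k.
  exact: poweR_ge0.
rewrite uE; split=> [[v <-]|Nu].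
  exact/poweR_lty/Lfunction_finite.
have uL : u \in Lfun (@counting nat R) p%:E.
  rewrite inE; apply/andP; split; rewrite inE//=.
  rewrite /finite_norm ltey; apply/eqP => uy.
  by move: Nu; rewrite uy poweRyr ?gt_eqF// ltxx.
by exists (Lfun_Sub (p1 : (1 <= p%:E)%E) uL).
Qed.

End lp_def.

Arguments lp {R p} p1.

(* A map B -> Y on the nonempty ball B is given by a total map X -> Y, of which
   only the values on B matter; ball c r is the open ball [set x | mdist c x < r]
   (see [ballEmdist]). *)
Definition locally_lipschitz_representable_with (R : realType)
    (X Y : metricType R) (lambda : R) : Prop :=
  forall (c : X) (r : R), 0 < r ->
  exists (f : X -> Y) (s : R), 0 < s /\
    forall x y : X, ball c r x -> ball c r y ->
      s * mdist x y <= mdist (f x) (f y) <= lambda * s * mdist x y.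

Definition locally_lipschitz_representable (R : realType)
    (X Y : metricType R) : Prop :=
  exists2 lambda : R, 1 <= lambda &
    locally_lipschitz_representable_with X Y lambda.

Definition bilipschitz_embedding (R : realType) (X : metricType R)
    (Z : normedModType R) (f : X -> Z) : Prop :=
  exists s D : R, [/\ 0 < s, 1 <= D &
    forall x y : X, s * mdist x y <= `|f x - f y| <= D * s * mdist x y].

(* Main.v *)
Require Import Defs.
From HB Require Import structures.
From mathcomp Require Import all_boot all_order all_algebra.
From mathcomp Require Import all_classical all_reals all_analysis.
From mathcomp Require Import ring lra.

Import Order.TTheory GRing.Theory Num.Theory.
Import numFieldNormedType.Exports.

(** Fix a base point [o] and put [t x := 1 + mdist o x].  For every [n] a
    rescaled and translated copy [f_n] of the local representation on the ball
    of radius [2 * 2 ^+ n] about [o] vanishes at [o] and satisfies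
    [mdist x y <= `|f_n x - f_n y| <= lambda * mdist x y] there.  Let [bump] be
    a Lipschitz function supported in [[1/4, 2]] and equal to [1] on
    [[1/2, 1]].  The maps [g_n x := bump (t x / 2 ^+ n) *: f_n x] are placed,
    together with one further coordinate that records [t x] itself, in the
    pieces of a decomposition of l^p into countably many copies of l^p:
      [F x := J_0 (t x *: e) + \sum_n J_{n+1} (g_n x)]  with [`|e| = 1],
    where [J_n] is the isometric inclusion of the n-th copy, for which there
    is a norm-one left inverse [P_n] that kills the other copies.

    Upper bound: [bump (t / 2 ^+ n)] has Lipschitz constant [5 / 2 ^+ n] in
    [t], while [f_n] has size at most [2 * lambda * 2 ^+ n] on the support, so
    each [g_n] is Lipschitz with a constant independent of [n] ([piece_lip]);
    moreover at most three of the [g_n] are nonzero at a given point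
    ([active_sum]).  Hence the sum is Lipschitz by the triangle inequality.

    Lower bound: let [t y <= t x] and choose [n] with
    [bump (t x / 2 ^+ n) = 1].  Replacing [f_n x - f_n y] by [g_n x - g_n y]
    costs the cutoff error
    [|bump (t x / 2 ^+ n) - bump (t y / 2 ^+ n)| * `|f_n y|], which is at most
    [10 * lambda * |t x - t y|] ([cutoff_lip]).  Projecting by [P_0] shows
    that [|t x - t y| <= `|F x - F y|], and projecting by [P_{n+1}] that
    [`|g_n x - g_n y| <= `|F x - F y|]; therefore
    [mdist x y <= (1 + 10 * lambda) * `|F x - F y|].

    The gluing ([gluing]) is carried out in any normed space with maps [J_n]
    and [P_n]; for l^p both are instances of a partial reindexing of
    sequences ([lp_reindex]) along a pairing of [nat * nat] with [nat]. *)

Local Open Scope classical_set_scope.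
Local Open Scope ring_scope.

(** * Partial reindexing of sequences in l^p *)

(** Injectivity of [tau] on the set where it is defined. *)
Definition partial_inj {A B : Type} (tau : A -> option B) :=
  forall i j b, tau i = Some b -> tau j = Some b -> i = j.

Lemma nneseries_reindex_le (R : realType) (a : nat -> \bar R)
    (tau : nat -> option nat) :
  (forall k, (0 <= a k)%E) -> partial_inj tau ->
  (\sum_(k <oo) oapp a 0 (tau k) <= \sum_(k <oo) a k)%E.
Proof.
move=> a0 tauI; rewrite !nneseries_esumT//; last first.
  by move=> k; case: (tau k) => /=.
have -> : (\esum_(k in [set: nat]) oapp a 0 (tau k) =
           \esum_(k in [set k | tau k]) a (odflt 0%N (tau k)))%E.
  rewrite [RHS]esum_mkcond; apply: eq_esum => k _.
  case: ifPn; rewrite ?inE ?notin_setE/=; first by case: (tau k).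
  by case: (tau k) => //= ? /(_ isT).
rewrite -(esum_image _ (fun k => odflt 0%N (tau k)))//; last first.
  move=> i j; rewrite !inE/=.
  case Ei : (tau i) => [b|]//= _; case Ej : (tau j) => [c|]//= _ bc.
  by apply: (tauI _ _ b) => //; rewrite Ej bc.
by rewrite esum_mkcond; apply: le_esum => k _; case: ifP.
Qed.

Section reindex.
Context {R : realType} {p : R} (p1 : 1 <= p).

Lemma lp_reindex_sum_le (tau : nat -> option nat) (u : lp p1) :
  partial_inj tau ->
  (\sum_(k <oo) (`|oapp (lp_seq u) 0 (tau k)| `^ p)%:E <=
   \sum_(k <oo) (`|lp_seq u k| `^ p)%:E)%E.
Proof.
move=> tauI; rewrite (@eq_eseriesr _ _
  (fun k => oapp (fun m => (`|lp_seq u m| `^ p)%:E) 0%E (tau k))).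
  by apply: nneseries_reindex_le => // k; rewrite lee_fin powR_ge0.
move=> k _; case: (tau k) => //=.
by rewrite normr0 powR0// gt_eqF// (lt_le_trans _ p1).
Qed.

Lemma lp_reindex_exists (tau : nat -> option nat) (u : lp p1) :
  partial_inj tau ->
  exists v : lp p1, lp_seq v = fun k => oapp (lp_seq u) 0 (tau k).
Proof.
move=> tauI; apply/lp_ofP; apply: le_lt_trans (lp_reindex_sum_le tau u tauI) _.
by apply/(lp_ofP p1 (lp_seq u)); exists u.
Qed.

(** The sequence whose k-th term is [u_(tau k)], or [0] where [tau k] is
    undefined. *)
Definition lp_reindex (tau : nat -> option nat) (tauI : partial_inj tau)
    (u : lp p1) : lp p1 := projT1 (cid (lp_reindex_exists tau u tauI)).

Lemma lp_reindexE tau tauI u k :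
  lp_seq (lp_reindex tau tauI u) k = oapp (lp_seq u) 0 (tau k).
Proof. by rewrite /lp_reindex; case: cid => v /= ->. Qed.

Lemma lp_eqP (u v : lp p1) : lp_seq u =1 lp_seq v -> u = v.
Proof. by move=> uv; apply/LfuneqP. Qed.

Lemma lp_reindex_linear tau tauI : linear (lp_reindex tau tauI).
Proof.
move=> a u v; apply: lp_eqP => k; rewrite lp_reindexE.
rewrite -[RHS]/(a * lp_seq (lp_reindex _ _ u) k + lp_seq (lp_reindex _ _ v) k).
rewrite !lp_reindexE; case: (tau k) => //=.
by rewrite mulr0 addr0.
Qed.

HB.instance Definition _ tau tauI :=
  GRing.isLinear.Build R (lp p1) (lp p1) _ (lp_reindex tau tauI)
    (lp_reindex_linear tau tauI).

Lemma lp_reindex_norm tau tauI u : `|lp_reindex tau tauI u| <= `|u|.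
Proof.
rewrite -lee_fin !lp_normE gt0_ler_poweR//.
  by rewrite invr_ge0 (le_trans _ p1).
1,2: by rewrite in_itv/= leey andbT nneseries_ge0// => k _ _;
  rewrite lee_fin powR_ge0.
under eq_eseriesr do rewrite lp_reindexE.
exact: lp_reindex_sum_le.
Qed.

(** * A decomposition of l^p into countably many copies of itself *)

(** The n-th block of indices consists of the codes [pickle (n, k)];
    [block_in_idx n] decodes the position k of an index in that block and is
    undefined on the other blocks. *)
Definition block_in_idx (n k : nat) : option nat :=
  obind (fun ij : nat * nat => if ij.1 == n then Some ij.2 else None)
        (pickle_inv k).

Definition block_out_idx (n k : nat) : option nat := Some (pickle (n, k)).

Lemma block_in_idx_inj n : partial_inj (block_in_idx n).
Proof.
move=> i j b; rewrite /block_in_idx.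
have := @pickle_invK (nat * nat)%type i.
have := @pickle_invK (nat * nat)%type j.
case: (pickle_inv j) => [[j1 j2]|]//= <-.
case: (pickle_inv i) => [[i1 i2]|]//= <-.
by case: eqP => // -> [->]; case: eqP => // -> [->].
Qed.

Lemma block_out_idx_inj n : partial_inj (block_out_idx n).
Proof.
by move=> i j b [<-] [] /(pcan_inj (@pickleK _)) [].
Qed.

(** [block_in n] places a sequence in the n-th block and extends it by zero;
    [block_out n] reads off the n-th block. *)
Definition block_in n := lp_reindex _ (block_in_idx_inj n).
Definition block_out n := lp_reindex _ (block_out_idx_inj n).

Lemma block_outK m n u :
  block_out m (block_in n u) = if m == n then u else 0.
Proof.
apply: lp_eqP => k; rewrite !lp_reindexE/= lp_reindexE.
rewrite /block_in_idx pickleK_inv/=.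
by case: ifP.
Qed.

Lemma lp_nontrivial : exists u : lp p1, u != 0.
Proof.
have [u uE] : exists u : lp p1, lp_seq u = fun k => (k == 0%N)%:R.
  apply/lp_ofP; rewrite (@eq_eseriesr _ _
    (fun k => if k == 0%N then 1%E else 0%E)); last first.
    move=> k _; case: eqP => _; first by rewrite normr1 powR1.
    by rewrite normr0 powR0// gt_eqF// (lt_le_trans _ p1).
  rewrite (nneseries_split 0 1)//; last by move=> k _; case: eqP.
  rewrite eseries0 ?adde0//; first by rewrite add0n big_nat1 ltry.
  by move=> [|k].
exists u; apply/eqP => u0; have := congr1 (fun v : lp p1 => lp_seq v 0%N) u0.
rewrite uE eqxx /= => /eqP.
by rewrite -[X in _ == X]/(0 : R) oner_eq0.
Qed.
End reindex.

(** * The cutoff function *)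

(** The projection of the real line onto [[0, 1]]. *)
Definition clamp {R : realType} (z : R) : R := Num.max 0 (Num.min 1 z).

(** This vanishes outside [[1/4, 2]], rises linearly from [0] to [1] on
    [[1/4, 1/2]], equals [1] on [[1/2, 1]], and decreases linearly to [0] on
    [[1, 2]]. *)
Definition bump {R : realType} (u : R) : R := clamp (2 - u) - clamp (2 - 4 * u).

Section bump.
Context {R : realType}.
Implicit Types u v : R.

Lemma clampP u : [\/ u <= 0 /\ clamp u = 0, 0 <= u <= 1 /\ clamp u = u
  | 1 <= u /\ clamp u = 1].
Proof.
rewrite /clamp; case: (lerP 1 u) => u1.
  by rewrite maxEle ler01; constructor 3.
by case: (lerP 0 u) => u0; [constructor 2 | constructor 1]; split=> //; lra.
Qed.

Lemma clamp_lip u v : `|clamp u - clamp v| <= `|u - v|.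
Proof.
rewrite ler_norml; apply/andP.
by case: (ler0P (u - v)) => ?; case: (clampP u) => -[? ->];
  case: (clampP v) => -[? ->]; lra.
Qed.

Lemma bump_lip u v : `|bump u - bump v| <= 5 * `|u - v|.
Proof.
have := clamp_lip (2 - u) (2 - v); have := clamp_lip (2 - 4 * u) (2 - 4 * v).
rewrite (_ : 2 - 4 * u - (2 - 4 * v) = (- 4) * (u - v)); last lra.
rewrite (_ : 2 - u - (2 - v) = - (u - v)); last lra.
rewrite normrM !normrN (ger0_norm (_ : (0:R) <= 4))// => h1 h2.
rewrite /bump.
have -> : clamp (2 - u) - clamp (2 - 4 * u) -
    (clamp (2 - v) - clamp (2 - 4 * v)) =
  (clamp (2 - u) - clamp (2 - v)) -
    (clamp (2 - 4 * u) - clamp (2 - 4 * v)) by lra.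
by apply: le_trans (ler_normB _ _) _; lra.
Qed.

Lemma bump_norm u : `|bump u| <= 1.
Proof.
rewrite ler_norml /bump; apply/andP.
by case: (clampP (2 - u)) => -[? ->]; case: (clampP (2 - 4 * u)) => -[? ->];
  lra.
Qed.

Lemma bump1 u : 2^-1 <= u <= 1 -> bump u = 1.
Proof.
move=> ?; rewrite /bump.
by case: (clampP (2 - u)) => -[? ->]; case: (clampP (2 - 4 * u)) => -[? ->];
  lra.
Qed.

Lemma bump_small u : 4 * u <= 1 -> bump u = 0.
Proof.
move=> ?; rewrite /bump.
by case: (clampP (2 - u)) => -[? ->]; case: (clampP (2 - 4 * u)) => -[? ->];
  lra.
Qed.

Lemma bump_large u : 2 <= u -> bump u = 0.
Proof.
move=> ?; rewrite /bump.
by case: (clampP (2 - u)) => -[? ->]; case: (clampP (2 - 4 * u)) => -[? ->];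
  lra.
Qed.
End bump.

(** * Gluing embeddings of balls *)

Section gluing.
Context {R : realType} {X : metricType R} {V : normedModType R}
  (J P : nat -> {linear V -> V})
  (J_norm : forall n u, `|J n u| <= `|u|)
  (P_norm : forall n u, `|P n u| <= `|u|)
  (PJ : forall m n u, P m (J n u) = if m == n then u else 0)
  (e : V) (e1 : `|e| = 1)
  (lambda : R) (lambda1 : 1 <= lambda) (o : X).

(* The shift by 1 makes [1 <= t x], so that the scales [2 ^+ n] with n a
   natural number suffice, also near [o]. *)
Let t (x : X) := 1 + mdist o x.

Context (f : nat -> X -> V)
  (fo : forall n, f n o = 0)
  (f_lip : forall n x y, t x <= 2 * 2 ^+ n -> t y <= 2 * 2 ^+ n ->
    mdist x y <= `|f n x - f n y| <= lambda * mdist x y).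

Let t_ge1 x : 1 <= t x. Proof. by rewrite /t lerDl mdist_ge0. Qed.

Let t_lip x y : `|t x - t y| <= mdist x y.
Proof.
rewrite ler_norml /t; apply/andP; split.
  by have := metric_triangle o x y; lra.
by have := metric_triangle o y x; rewrite (metric_sym y x); lra.
Qed.

Let pow2_gt0 n : 0 < 2 ^+ n :> R. Proof. exact: exprn_gt0. Qed.

(* The cutoff at scale n, and the localized map. *)
Let w n x : R := bump (t x / 2 ^+ n).
Let g n x : V := w n x *: f n x.

Let w_norm n x : `|w n x| <= 1.
Proof. exact: bump_norm. Qed.

Let w_small n x : 4 * t x <= 2 ^+ n -> w n x = 0.
Proof. by move=> h; apply: bump_small; rewrite mulrA ler_pdivrMr// mul1r. Qed.

Let w_large n x : 2 * 2 ^+ n <= t x -> w n x = 0.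
Proof. by move=> h; apply: bump_large; rewrite ler_pdivlMr. Qed.

Let f_norm n x : t x <= 2 * 2 ^+ n -> `|f n x| <= lambda * t x.
Proof.
move=> tx; have to : t o = 1 by rewrite /t mdistxx addr0.
have /andP[_] : mdist x o <= `|f n x - f n o| <= lambda * mdist x o.
  apply: f_lip => //; rewrite to; have := exprn_ege1 n (ler1n R 2); lra.
rewrite fo subr0 metric_sym => /le_trans; apply.
by rewrite ler_wpM2l ?(le_trans _ lambda1)// /t lerDr.
Qed.

(** The cutoff varies by at most [5 * |t x - t y| / 2 ^+ n], and the factor
    [2 ^+ n] is compensated by the size of [f n y]. *)
Let cutoff_lip n x y : t y <= 2 * 2 ^+ n ->
  `|w n x - w n y| * `|f n y| <= 10 * lambda * `|t x - t y|.
Proof.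
move=> ty.
apply: le_trans (_ : (5 * (`|t x - t y| / 2 ^+ n)) *
                     (lambda * (2 * 2 ^+ n)) <= _).
  apply: ler_pM => //.
    rewrite /w; apply: le_trans (bump_lip _ _) _.
    by rewrite -mulrBl normrM normfV (gtr0_norm (pow2_gt0 n)).
  apply: le_trans (f_norm _ _ ty) _.
  by rewrite ler_wpM2l// (le_trans _ lambda1).
have p0 := lt0r_neq0 (pow2_gt0 n).
rewrite le_eqVlt; apply/orP; left; apply/eqP.
by field.
Qed.

(* [active n x] is the indicator of [2 ^+ n < 4 * t x <= 2 ^+ (n + 3)], an
   interval that contains every [4 * t x] with [w n x != 0]. *)
Let G n x : R := (2 ^+ n < 4 * t x)%R%:R.
Let active n x : R := G n x - G (n + 3) x.

Let active_ge0 n x : 0 <= active n x.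
Proof.
rewrite subr_ge0 /G exprD; case: (ltP (2 ^+ n * 2 ^+ 3)) => // h.
suff -> : 2 ^+ n < 4 * t x by [].
by have := pow2_gt0 n; move: h; rewrite 3!exprS expr0; lra.
Qed.

Let w_neq0 n x : w n x != 0 -> active n x = 1.
Proof.
move=> wn0; rewrite /active /G exprD.
have -> : 2 ^+ n < 4 * t x.
  by rewrite ltNge; apply: contra wn0 => ?; apply/eqP/w_small.
have -> : (2 ^+ n * 2 ^+ 3 < 4 * t x) = false.
  apply/negbTE; apply: contra wn0 => h; apply/eqP/w_large.
  by move: h; rewrite 3!exprS expr0; lra.
by rewrite subr0.
Qed.

Let active_sum M x : \sum_(n < M) active n x <= 3.
Proof.
(* [active n x] is the difference of consecutive terms of H, so the sum
   telescopes to [H 0 - H M]. *)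
pose H n := G n x + G n.+1 x + G n.+2 x.
have HE n : active n x = H n - H n.+1 by rewrite /active /H addn3; lra.
rewrite (eq_bigr (fun n : 'I_M => H n - H n.+1))//.
rewrite -(big_mkord xpredT (fun n => H n - H n.+1)).
under eq_bigr do rewrite -opprB.
rewrite sumrN telescope_sumr// opprB.
have G01 n : 0 <= G n x <= 1 by rewrite /G; case: ltP; rewrite ?ler01 ?lexx.
have := G01 0%N; have := G01 1%N; have := G01 2%N.
have := G01 M; have := G01 M.+1; have := G01 M.+2.
rewrite /H; lra.
Qed.

(** If both points lie in the domain of [f n], the constant 11 is 1 for the
    variation of [f n] plus 10 for that of the cutoff; if only [y] does, then
    [g n x] vanishes and the variation of the cutoff alone is enough. *)
Let piece_lip n x y :
  `|g n x - g n y| <= 11 * lambda * mdist x y * (active n x + active n y).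
Proof.
wlog txy : x y / t y <= t x => [th|].
  have [/th//|/ltW/th {th}] := leP (t y) (t x).
  by rewrite distrC metric_sym (addrC (active n x)).
have l0 : 0 <= lambda by exact: le_trans lambda1.
have d0 := mdist_ge0 x y.
have ld0 : 0 <= lambda * mdist x y by rewrite mulr_ge0.
have Ix := active_ge0 n x; have Iy := active_ge0 n y.
have [wx|wx0] := eqVneq (w n x) 0.
  have [wy|wy] := eqVneq (w n y) 0.
    rewrite /g wx wy !scale0r subr0 normr0.
    by apply: mulr_ge0; [lra|exact: addr_ge0].
  have ty : t y <= 2 * 2 ^+ n.
    by rewrite leNgt; apply: contra wy => /ltW/w_large ->.
  have := cutoff_lip n x y ty.
  rewrite /g wx scale0r !sub0r !normrN normrZ (w_neq0 n y wy) => /le_trans.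
  apply.
  have := ler_wpM2l l0 (t_lip x y).
  have := mulr_ge0 ld0 Ix.
  lra.
have tx : t x <= 2 * 2 ^+ n.
  rewrite leNgt; apply/negP => /ltW/w_large wx.
  by have := wx0; rewrite wx eqxx.
have ty : t y <= 2 * 2 ^+ n by exact: le_trans tx.
have -> : g n x - g n y = w n x *: (f n x - f n y) + (w n x - w n y) *: f n y.
  by rewrite /g scalerBr (scalerBl (w n x)) addrA subrK.
apply: le_trans (ler_normD _ _) _; rewrite !normrZ.
have /andP[_ h1] := f_lip n x y tx ty.
have h2 := ler_pM (normr_ge0 _) (normr_ge0 _) (w_norm n x) h1.
have h3 := cutoff_lip n x y ty; have h4 := ler_wpM2l l0 (t_lip x y).
have h5 := mulr_ge0 ld0 Iy.
rewrite (w_neq0 n x wx0); lra.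
Qed.

Let exists_scale x : exists N, 4 * t x <= 2 ^+ N.
Proof.
have t0 : 0 <= 4 * t x by have := t_ge1 x; lra.
exists (Num.bound (4 * t x)); apply: le_trans (ltW (archi_boundP t0)) _.
by rewrite -natrX ler_nat ltnW// ltn_expl.
Qed.

(** The scale n is the least one with [t x <= 2 ^+ n]. *)
Let g_lower x y : t y <= t x ->
  exists n, mdist x y <= `|g n x - g n y| + 10 * lambda * `|t x - t y|.
Proof.
move=> txy.
have [n wn tn] : exists2 n, w n x = 1 & t x <= 2 ^+ n.
  have scale : exists n, t x <= 2 ^+ n.
    by have [n h] := exists_scale x; exists n; have := t_ge1 x; lra.
  have [n tn n_min] := ex_minnP scale; exists n => //.
  apply: bump1; rewrite ler_pdivlMr// ler_pdivrMr// mul1r tn andbT.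
  case: n tn n_min => [_ _|n _ n_min].
    by have := t_ge1 x; rewrite expr0; lra.
  rewrite exprS mulKf// leNgt; apply/negP => /ltW/n_min.
  by rewrite ltnn.
exists n.
have tx : t x <= 2 * 2 ^+ n by have := pow2_gt0 n; lra.
have ty : t y <= 2 * 2 ^+ n by exact: le_trans tx.
have /andP[h _] := f_lip n x y tx ty.
apply: le_trans h _; have := cutoff_lip n x y ty.
rewrite -normrZ (scalerBl (w n x)) => wl.
have -> : f n x - f n y = (g n x - g n y) - (w n x *: f n y - w n y *: f n y).
  by rewrite /g wn !scale1r opprB addrA subrK.
by apply: le_trans (ler_normB _ _) _; rewrite lerD2l.
Qed.

(** If the balls [t x <= 2 * 2 ^+ n] about [o] embed into V with distortion
    lambda and V contains countably many complemented copies of itself, in the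
    sense of the maps J and P, then X embeds into V. *)
Lemma gluing : exists F : X -> V, bilipschitz_embedding F.
Proof.
have /choice[N NP] := exists_scale.
(* The pieces with [N x <= n] vanish at x, so the sum defining [F x] is finite
   and may be extended to any larger range. *)
pose F x : V := J 0%N (t x *: e) + \sum_(n < N x) J n.+1 (g n x).
have FE x M : (N x <= M)%N ->
    F x = J 0%N (t x *: e) + \sum_(n < M) J n.+1 (g n x).
  move=> NM; congr (_ + _).
  rewrite -!(big_mkord xpredT (fun n => J n.+1 (g n x))).
  rewrite [RHS](big_cat_nat _ NM)//= [X in _ = _ + X](_ : _ = 0) ?addr0//.
  rewrite big_nat_cond big1// => n /andP[/andP[Nn _] _].
  rewrite /g w_small ?scale0r ?linear0//.
  by apply: le_trans (NP x) _; rewrite ler_weXn2l// ler1n.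
have P0 x : P 0%N (F x) = t x *: e.
  by rewrite linearD linear_sum/= PJ eqxx big1 ?addr0//.
have PS n x : P n.+1 (F x) = g n x.
  rewrite (FE x (maxn (N x) n.+1)) ?leq_maxl// linearD linear_sum/= PJ add0r.
  rewrite (bigD1 (Ordinal (leq_maxr (N x) n.+1)))//= PJ eqxx big1 ?addr0//.
  by move=> i; rewrite -val_eqE/= PJ eqSS eq_sym => /negPf ->.
have low1 x y : `|t x - t y| <= `|F x - F y|.
  apply: le_trans (P_norm 0%N _).
  by rewrite linearB/= !P0 -scalerBl normrZ e1 mulr1.
have low2 n x y : `|g n x - g n y| <= `|F x - F y|.
  by rewrite -!PS -linearB; exact: P_norm.
have l0 : 0 <= lambda by exact: le_trans lambda1.
(* The Lipschitz constant of F is 1 from the coordinate [t] plus 11 * lambda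
   for each of the at most 3 + 3 pieces active at x or at y. *)
exists F, (1 + 10 * lambda)^-1, ((1 + 66 * lambda) * (1 + 10 * lambda)); split.
- by rewrite invr_gt0; lra.
- by nra.
move=> x y; apply/andP; split.
  rewrite ler_pdivrMl; last lra.
  wlog txy : x y / t y <= t x => [th|].
    have [/th//|/ltW/th {th}] := leP (t y) (t x).
    by rewrite distrC metric_sym.
  have [n h] := g_lower x y txy.
  have := low2 n x y; have := ler_wpM2l l0 (low1 x y).
  lra.
rewrite mulfK; last lra.
have NM := leq_maxl (N x) (N y); have NM' := leq_maxr (N x) (N y).
rewrite (FE x _ NM) (FE y _ NM') opprD addrACA -linearB -scalerBl.
rewrite -sumrB.
apply: le_trans (ler_normD _ _) _.
rewrite mulrDl mul1r; apply: lerD.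
  apply: le_trans (J_norm _ _) _.
  by rewrite normrZ e1 mulr1.
apply: le_trans (ler_norm_sum _ _ _) _.
apply: le_trans (_ : \sum_(n < maxn (N x) (N y))
   11 * lambda * mdist x y * (active n x + active n y) <= _).
  apply: ler_sum => n _; rewrite -linearB.
  exact: le_trans (J_norm _ _) (piece_lip _ _ _).
rewrite -mulr_sumr big_split/=.
have ld0 : 0 <= 11 * lambda * mdist x y by rewrite !mulr_ge0// mdist_ge0.
apply: le_trans (ler_wpM2l ld0 (lerD (active_sum _ x) (active_sum _ y))) _.
lra.
Qed.
End gluing.

Theorem corollary1 (R : realType) (p : R) (p1 : 1 <= p) (X : metricType R) :
  locally_lipschitz_representable X (lp p1) ->
  exists f : X -> lp p1, bilipschitz_embedding f.
Proof.
move=> [lambda lambda1 Xlp].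
have [Xo|Xe] := pselect (exists o : X, True); last first.
  exists (fun=> 0), 1, 1; split=> // x.
  by exfalso; apply: Xe; exists x.
case: Xo => o _.
have [u u0] := lp_nontrivial p1.
(* The local representation on a ball, rescaled so that it does not contract
   distances and translated so that it vanishes at [o]. *)
have f_ex n : exists h : X -> lp p1, h o = 0 /\
    forall x y, 1 + mdist o x <= 2 * 2 ^+ n -> 1 + mdist o y <= 2 * 2 ^+ n ->
    mdist x y <= `|h x - h y| <= lambda * mdist x y.
  have r0 : 0 < 2 * 2 ^+ n :> R by rewrite mulr_gt0// exprn_gt0.
  have [h [s [s0 hP]]] := Xlp o _ r0.
  exists (fun x => s^-1 *: (h x - h o)); split; first by rewrite subrr scaler0.
  move=> x y tx ty.
  rewrite -scalerBr opprB addrA subrK normrZ gtr0_norm ?invr_gt0//.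
  rewrite ler_pdivlMl// ler_pdivrMl// mulrCA mulrA.
  by apply: hP; rewrite ballEmdist/=; lra.
have /choice[f fP] := f_ex.
apply: (@gluing R X (lp p1) (@block_in R p p1) (@block_out R p p1)
  _ _ _ (`|u|^-1 *: u) _ lambda _ o f).
- by move=> n v; exact: lp_reindex_norm.
- by move=> n v; exact: lp_reindex_norm.
- exact: block_outK.
- by rewrite normrZ normfV normr_id mulVf// normr_eq0.
- exact: lambda1.
- by move=> n; have [] := fP n.
- by move=> n; have [] := fP n.
Qed.
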